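(* Let $H,G:\mathbb{R}^n\rightrightarrows\mathbb{R}^n$ be closed convex processes such that $\mathcal{F}(H)^-\cap\operatorname{cl}(\mathcal{F}(G))=\{0\}$ and such that for all $x\in\mathcal{F}(H)$ and $q\in\mathcal{F}(G)$: \[\inf_{p\in\mathcal{F}(G)\cap G(q)} p\cdot x\;\le\;\sup_{y\in\mathcal{F}(H)\cap H(x)} y\cdot q.\] If $V\in\mathcal{V}$ is a strong Lyapunov function for $H$, then $W:=(V|_{\mathcal{F}(H)})^\star$ is a weak Lyapunov function for $G$.
   Context: A set-valued map $H:\mathbb{R}^n\rightrightarrows\mathbb{R}^n$ is a convex process if its graph $\{(x,y)\mid y\in H(x)\}$ is a convex cone, and closed if the graph is closed. For a set-valued map $G$, a trajectory is a sequence $(x_k)_{k\ge0}$ with $x_{k+1}\in G(x_k)$ for all $k\ge0$, and $\mathcal{F}(G)$ is the set of $\xi$ such that some trajectory has $x_0=\xi$. For a set $\mathcal{C}$, $\mathcal{C}^-=\{y\mid\langle x,y\rangle\le0\ \forall x\in\mathcal{C}\}$; $\operatorname{cl}$ denotes closure. $\mathcal{V}$ is the set of extended real-valued functions $f:\mathbb{R}^n\to\mathbb{R}\cup\{\pm\infty\}$ that are closed and convex (closed convex epigraph), positive semi-definite ($f(0)=0$, $f\ge0$) and positively homogeneous of degree 2 ($f(\lambda x)=\lambda^2f(x)$ for $\lambda\ge0$). For a convex cone $\mathcal{C}$, $f\in\mathcal{V}$ is positive definite with respect to $\mathcal{C}$ if there exist $0<\alpha\le\beta<\infty$ with $\alpha\|x\|^2\le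 f(x)\le\beta\|x\|^2$ for all $x\in\mathcal{C}$. $f|_{\mathcal{C}}(x)=f(x)$ if $x\in\mathcal{C}$ and $+\infty$ otherwise; $f^\star(y)=\sup_x\{y\cdot x-f(x)\}$ is the convex conjugate. For a convex process $K$: $V\in\mathcal{V}$ is a weak Lyapunov function for $K$ if $V$ is positive definite with respect to $\mathcal{F}(K)$ and there is $\gamma\in(0,1)$ such that for every $x\in\mathcal{F}(K)$ there exists $y\in\mathcal{F}(K)\cap K(x)$ with $V(y)\le\gamma V(x)$; $V\in\mathcal{V}$ is a strong Lyapunov function for $K$ if $V$ is positive definite with respect to $\mathcal{F}(K)$ and there is $\gamma\in(0,1)$ such that for every $x\in\mathcal{F}(K)$ and every $y\in\mathcal{F}(K)\cap K(x)$, $V(y)\le\gamma V(x)$. *)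

(* Defs.v *)
From HB Require Import structures.
From mathcomp Require Import all_boot all_order all_algebra.
From mathcomp Require Import boolp classical_sets reals constructive_ereal ereal topology normedtype.
Set Implicit Arguments. Unset Strict Implicit. Unset Printing Implicit Defensive.
Import Order.TTheory GRing.Theory Num.Theory.
Import numFieldNormedType.Exports.
Local Open Scope classical_set_scope.
Local Open Scope ring_scope.

Section Defs.
Variables (R : realType) (n : nat).
Notation vec := 'rV[R]_n.

Definition dot (x y : vec) : R := \sum_(i < n) x ord0 i * y ord0 i.

Definition setmap := vec -> set vec.

Definition graph (H : setmap) : set (vec * vec) := [set p | H p.1 p.2].

Definition convex_cone_pair (C : set (vec * vec)) : Prop :=
  C (0, 0) /\
  (forall p q, C p -> C q -> C (p.1 + q.1, p.2 + q.2)) /\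
  (forall (l : R) p, 0 <= l -> C p -> C (l *: p.1, l *: p.2)).

Definition convex_process (H : setmap) : Prop := convex_cone_pair (graph H).
Definition closed_process (H : setmap) : Prop := closed (graph H).

Definition feasible (G : setmap) : set vec :=
  [set xi | exists x : nat -> vec, x 0%N = xi /\ forall k, G (x k) (x k.+1)].

Definition polar (C : set vec) : set vec :=
  [set y | forall x, C x -> dot x y <= 0].

Definition epigraph (f : vec -> \bar R) : set (vec * R) :=
  [set p | (f p.1 <= p.2%:E)%E].

Definition convex_set_pair (S : set (vec * R)) : Prop :=
  forall p q (l : R), S p -> S q -> 0 <= l <= 1 ->
    S (l *: p.1 + (1 - l) *: q.1, l * p.2 + (1 - l) * q.2).

Definition classV (f : vec -> \bar R) : Prop :=
  closed (epigraph f) /\ convex_set_pair (epigraph f) /\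
  f 0 = 0%E /\ (forall x, (0 <= f x)%E) /\
  (forall (l : R) x, 0 <= l -> f (l *: x) = ((l ^+ 2)%:E * f x)%E).

Definition posdef_wrt (C : set vec) (f : vec -> \bar R) : Prop :=
  exists alpha beta : R, 0 < alpha /\ alpha <= beta /\
    forall x, C x -> ((alpha * dot x x)%:E <= f x /\ f x <= (beta * dot x x)%:E)%E.

Definition restrict (f : vec -> \bar R) (C : set vec) : vec -> \bar R :=
  fun x => if `[< C x >] then f x else +oo%E.

Definition conjugate (f : vec -> \bar R) : vec -> \bar R :=
  fun y => ereal_sup [set ((dot y x)%:E - f x)%E | x in [set: vec]].

Definition weak_lyapunov (V : vec -> \bar R) (K : setmap) : Prop :=
  classV V /\ posdef_wrt (feasible K) V /\
  exists gamma : R, 0 < gamma < 1 /\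
    forall x, feasible K x -> exists y, feasible K y /\ K x y /\
      (V y <= gamma%:E * V x)%E.

Definition strong_lyapunov (V : vec -> \bar R) (K : setmap) : Prop :=
  classV V /\ posdef_wrt (feasible K) V /\
  exists gamma : R, 0 < gamma < 1 /\
    forall x, feasible K x -> forall y, feasible K y -> K x y ->
      (V y <= gamma%:E * V x)%E.
End Defs.

(* Main.v *)
Require Import Defs.
From HB Require Import structures.
From mathcomp Require Import all_boot all_order all_algebra.
From mathcomp Require Import boolp classical_sets reals constructive_ereal ereal topology normedtype.
From mathcomp Require Import ring lra.
Import Order.TTheory GRing.Theory Num.Theory.
Import numFieldNormedType.Exports.
Local Open Scope classical_set_scope.
Local Open Scope ring_scope.

(* Write C = F(H), v = V on C, and w = (V|_C)^*. On P = F(G) `&` G(q) we need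
   a p with w p <= gamma' * w q. Otherwise sup_{x in C} (p.x - v x) > m for all
   p in P. Since C^- meets cl F(G) only at 0, compactness of the unit sphere
   gives finitely many x in C whose linear forms dominate the norm on F(G);
   they handle the far part of P, and compactness handles the bounded part.
   So finitely many of the affine functions p.x - v x already have maximum
   above m' on P, and a finite minimax argument merges them into a single x,
   which lies in C itself and not merely in its closure. Then
   inf_P p.x >= m' + v x, and the duality hypothesis yields y in H(x) with
   y.q > m0 + v y / gamma, against w q >= (y/gamma).q - v (y/gamma). *)

(** * Minimax for finitely many affine functions on a convex set *)

Section FiniteMinimax.
Context {R : realType} {V : lmodType R}.

Definition convex_set (P : set V) : Prop :=
  forall (t : R) p q, P p -> P q -> 0 <= t <= 1 -> P (t *: p + (1 - t) *: q).

Definition affine (f : V -> R) : Prop :=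
  forall (t : R) p q, f (t *: p + (1 - t) *: q) = t * f p + (1 - t) * f q.

(** The multiplier is [s], the infimum of [h p / - g p] over the points with [g p < 0]. Those points
    force any multiplier to be at most [s]; a point with [h p < 0 < g p] forces it to be at least
    [- h p / g p], and [cross] says that these demands are compatible. Normalising [s * g + h] gives
    the weight [s / (1 + s)]. *)
Lemma affine_alternative2 (P : set V) (g h : V -> R) :
  convex_set P -> affine g -> affine h ->
  (forall p, P p -> h p <= 0 -> 0 <= g p) ->
  exists t : R, 0 <= t <= 1 /\ forall p, P p -> 0 <= t * g p + (1 - t) * h p.
Proof.
move=> cP ag ah gh.
have [[r [Pr gr]]|/forallNP noneg] := pselect (exists p, P p /\ g p < 0); last first.
  exists 1; split=> [|p Pp]; first by lra.
  have : ~~ (g p < 0) by apply/negP => gp; apply: (noneg p).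
  by rewrite -leNgt; lra.
have hpos p : P p -> g p < 0 -> 0 < h p.
  by move=> Pp gp; rewrite ltNge; apply/negP => /(gh p Pp); lra.
(* The segment from p to p' meets {h = 0} at a point where g >= 0. *)
have cross p p' : P p -> h p < 0 -> P p' -> g p' < 0 -> h p * g p' <= h p' * g p.
  move=> Pp hp Pp' gp'; have hp' := hpos _ Pp' gp'.
  have d0 : 0 < h p' - h p by lra.
  pose t := h p' / (h p' - h p).
  have tE : t * (h p' - h p) = h p' by rewrite mulfVK // gt_eqF.
  have t01 : 0 <= t <= 1.
    by rewrite /t divr_ge0 ?(ltW hp') ?(ltW d0) //= ler_pdivrMr //; lra.
  have Pm := cP t p p' Pp Pp' t01.
  have hm : h (t *: p + (1 - t) *: p') = 0.
    by rewrite ah; move: tE; lra.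
  have := gh _ Pm; rewrite hm ag lexx => /(_ isT) gm.
  have : 0 <= (t * g p + (1 - t) * g p') * (h p' - h p) by rewrite mulr_ge0 // ltW.
  have -> : (t * g p + (1 - t) * g p') * (h p' - h p) =
     (t * (h p' - h p)) * (g p - g p') + g p' * (h p' - h p) by ring.
  by rewrite tE; lra.
pose T := [set h p / - g p | p in [set p | P p /\ g p < 0]].
pose s := inf T.
have T0 : T !=set0 by exists (h r / - g r); exists r.
have lbT : has_lbound T.
  exists 0 => _ [p [Pp gp] <-]; have := hpos p Pp gp => hp.
  by rewrite divr_ge0 //; lra.
have s0 : 0 <= s.
  apply: lb_le_inf => // _ [p [Pp gp] <-]; have := hpos p Pp gp => hp.
  by rewrite divr_ge0 //; lra.
have main p : P p -> 0 <= s * g p + h p.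
  move=> Pp; have [gp|gp|gp] := ltgtP (g p) 0.
  - have : s <= h p / - g p by apply: ge_inf => //; exists p.
    by rewrite ler_pdivlMr; lra.
  - have [hp|hp] := leP 0 (h p); first by rewrite addr_ge0 // mulr_ge0 // ltW.
    have : - h p / g p <= s.
      apply: lb_le_inf => // _ [p' [Pp' gp'] <-].
      have := cross p p' Pp hp Pp' gp'.
      rewrite ler_pdivlMr; last by lra.
      rewrite mulrAC ler_pdivrMr //.
      by lra.
    by rewrite ler_pdivrMr //; lra.
  - have [hp|hp] := leP 0 (h p); first by rewrite gp mulr0 add0r.
    have := cross p r Pp hp Pr gr; rewrite gp mulr0.
    by rewrite nmulr_rle0 // leNgt gr.
have s1 : 0 < 1 + s by lra.
exists (s / (1 + s)); split.
  by rewrite divr_ge0 //= ?ler_pdivrMr //; lra.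
move=> p /main mp.
have -> : s / (1 + s) * g p + (1 - s / (1 + s)) * h p = (s * g p + h p) / (1 + s).
  by field; rewrite gt_eqF.
by rewrite divr_ge0 // ltW.
Qed.

(** Induction on [s]. Covering is strict, so on the slice [g y p <= 0] the index [y] is never the
    witness and the remaining indices cover. The [x] obtained there is merged with [y] by
    [affine_alternative2], and the domination hypothesis replaces the convex combination by one
    index of [X]. *)
Lemma finite_minimax (T : eqType) (X : set T) (g : T -> V -> R) :
  (forall x, affine (g x)) -> X !=set0 ->
  (forall (t : R) x y, X x -> X y -> 0 <= t <= 1 ->
     exists2 z, X z & forall p, t * g x p + (1 - t) * g y p <= g z p) ->
  forall (s : seq T) (P : set V), convex_set P -> (forall x, x \in s -> X x) ->
  (forall p, P p -> exists x, x \in s /\ 0 < g x p) ->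
  exists2 x, X x & forall p, P p -> 0 <= g x p.
Proof.
move=> ag [x0 Xx0] cX; elim=> [|y s IH] P cP sX cov.
  by exists x0 => // p /cov[x []].
have Xy : X y by apply: sX; rewrite mem_head.
have [||p [Pp gp]|x Xx hx] := IH (P `&` [set p | g y p <= 0]).
- move=> t p q [Pp gp] [Pq gq] t01; split; first exact: cP.
  rewrite /= ag; have /andP[t0 t1] := t01.
  by rewrite -oppr_ge0 opprD -!mulrN addr_ge0 // mulr_ge0 ?subr_ge0 ?oppr_ge0.
- by move=> x xs; apply: sX; rewrite inE xs orbT.
- have [x [+ gx]] := cov p Pp; rewrite inE => /predU1P[xy|xs]; last by exists x.
  by move: gp; rewrite /= leNgt -xy gx.
have [t [t01 ht]] := @affine_alternative2 P (g x) (g y) cP (ag x) (ag y)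
  (fun p Pp gp => hx p (conj Pp gp)).
have [z Xz hz] := cX t x y Xx Xy t01.
by exists z => // p Pp; apply: le_trans (hz p); exact: ht.
Qed.

End FiniteMinimax.

(** * Inner product, its continuity, and compactness in row vectors *)

Section Dot.
Context {R : realType} {n : nat}.
Implicit Types x y z p q : 'rV[R]_n.

Lemma dotC x y : dot x y = dot y x.
Proof. by apply: eq_bigr => i _; rewrite mulrC. Qed.

Lemma dotDl x y z : dot (x + y) z = dot x z + dot y z.
Proof. by rewrite -big_split; apply: eq_bigr => i _; rewrite mxE mulrDl. Qed.

Lemma dotZl (a : R) x y : dot (a *: x) y = a * dot x y.
Proof. by rewrite /dot mulr_sumr; apply: eq_bigr => i _; rewrite mxE mulrA. Qed.

Lemma dotDr x y z : dot z (x + y) = dot z x + dot z y.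
Proof. by rewrite !(dotC z) dotDl. Qed.

Lemma dotZr (a : R) x y : dot y (a *: x) = a * dot y x.
Proof. by rewrite !(dotC y) dotZl. Qed.

Lemma dotBl x y z : dot (x - y) z = dot x z - dot y z.
Proof. by rewrite -scaleN1r dotDl dotZl mulN1r. Qed.

Lemma dotBr x y z : dot z (x - y) = dot z x - dot z y.
Proof. by rewrite !(dotC z) dotBl. Qed.

Lemma dot0r x : dot x 0 = 0.
Proof. by rewrite -(scale0r 0) dotZr mul0r. Qed.

Lemma dot_ge0 x : 0 <= dot x x.
Proof. by apply: sumr_ge0 => i _; rewrite -expr2 sqr_ge0. Qed.

Lemma dot_gt0 x : x != 0 -> 0 < dot x x.
Proof.
move=> x0; rewrite lt_neqAle dot_ge0 andbT eq_sym; apply: contra x0 => /eqP d0.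
apply/eqP/rowP => i; rewrite mxE; apply/eqP.
have xx0 j : true -> 0 <= x ord0 j * x ord0 j by rewrite -expr2 sqr_ge0.
have /eqP : x ord0 i * x ord0 i = 0 by exact: (psumr_eq0P xx0 d0).
by rewrite -expr2 sqrf_eq0.
Qed.

(** Expand the square of [x - (2 * a) *: y]. This bounds the conjugate from above and absorbs
    perturbations of the linear form. *)
Lemma dot_young (a : R) x y : 0 < a -> dot x y <= a * dot y y + dot x x / (4 * a).
Proof.
move=> a0; have := dot_ge0 (x - (2 * a) *: y).
rewrite !(dotBl, dotBr, dotZl, dotZr) (dotC y x) => h.
have a4 : 0 < 4 * a by lra.
rewrite -lerBlDl ler_pdivlMr //; lra.
Qed.

Lemma sum_continuous (T : topologicalType) (f : 'I_n -> T -> R) :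
  (forall i, continuous (f i)) -> continuous (fun t => \sum_(i < n) f i t).
Proof.
move=> cf t; apply: (@cvg_big _ _ +%R 0 xpredT) => [|i _]; last exact: cf.
exact: add_continuous.
Qed.

Lemma continuous_dot (T : topologicalType) (f g : T -> 'rV[R]_n) :
  continuous f -> continuous g -> continuous (fun t => dot (f t) (g t)).
Proof.
move=> cf cg; apply: sum_continuous => i t.
apply: cvgM; (apply: (@continuous_comp _ _ _ _ (fun M : 'rV[R]_n => M ord0 i));
  [exact: cf || exact: cg | exact: coord_continuous]).
Qed.

Lemma dot_continuous x : continuous (dot x).
Proof. by apply: continuous_dot; [exact: cst_continuous | move=> t; exact: cvg_id]. Qed.

Lemma closure_approx (A : set 'rV[R]_n) p (e : R) :
  closure A p -> 0 < e -> exists2 q, A q & dot (q - p) (q - p) < e.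
Proof.
move=> Ap e0.
have [|q [Aq qe]] := Ap [set q | dot (q - p) (q - p) < e]; last by exists q.
have cf : continuous (fun q => dot (q - p) (q - p)).
  have cB : continuous (fun q : 'rV[R]_n => q - p).
    by move=> t; apply: (@continuousB _ _ _ id (fun=> p)); [exact: cvg_id | exact: cst_continuous].
  exact: continuous_dot.
apply: (cf p [set r : R | r < e]); apply: open_nbhs_nbhs; split; first exact: open_lt.
by rewrite /= subrr dot0r.
Qed.

Lemma compact_dot_le (A : set 'rV[R]_n) (r : R) :
  closed A -> compact (A `&` [set p | dot p p <= r]).
Proof.
move=> cA; apply: bounded_closed_compact.
  (* A coordinate with square at most [r] has absolute value at most [1 + |r|]; this form needs
     neither a square root nor a sign condition on [r]. *)
  exists (1 + `|r|); split; first exact: num_real.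
  move=> M rM p [_ /= pr].
  rewrite [leLHS]/Num.Def.normr/= mx_normrE.
  have M0 : 0 <= M by rewrite (le_trans _ (ltW rM)) // addr_ge0.
  apply/bigmax_leP; split=> // -[i j] _ /=; rewrite (ord1 i).
  have pj : p ord0 j ^+ 2 <= r.
    apply: le_trans pr; rewrite /dot (bigD1 j) //= -expr2 lerDl.
    by apply: sumr_ge0 => k _; rewrite -expr2 sqr_ge0.
  rewrite leNgt; apply/negP => Mp.
  have h := ler_norm r; have := normr_ge0 r => h'.
  have := real_normK (num_real (p ord0 j)) => e2.
  by nra.
apply: closedI => //.
apply: (@preimage_closed _ _ (fun p : 'rV[R]_n => dot p p) [set s | s <= r]);
  last exact: closed_le.
by move=> p _; apply: continuous_dot => t; exact: cvg_id.
Qed.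

Lemma compact_seq_cover {T : ptopologicalType} {I : choiceType} (K : set T)
    (D : set I) (f : I -> set T) :
  compact K -> (forall i, D i -> open (f i)) ->
  (forall t, K t -> exists i, D i /\ f i t) ->
  exists s : seq I, (forall i, i \in s -> D i) /\
    forall t, K t -> exists i, i \in s /\ f i t.
Proof.
rewrite compact_cover => cK fo cov.
have [|D' D'D KD'] := cK _ D f fo.
  by move=> t /cov[i [Di fi]]; exists i.
exists (finmap.enum_fset D'); split=> [i /D'D|t /KD'[i iD' fi]]; last by exists i.
by rewrite inE.
Qed.

Lemma open_dot_gt x (c : R) : open [set p | c < dot x p].
Proof.
apply: (@open_comp _ _ (dot x) [set r | c < r]); last exact: open_gt.
by move=> p _; exact: dot_continuous.
Qed.

End Dot.

Lemma seq_ubound {R : realType} {T : eqType} (s : seq T) (f : T -> R) :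
  exists M, forall x, x \in s -> f x <= M.
Proof.
elim: s => [|y s [M hM]]; first by exists 0.
exists (Num.max (f y) M) => x; rewrite inE le_max => /predU1P[->|/hM ->].
  by rewrite lexx.
by rewrite orbT.
Qed.

(** * The conjugate of a quadratic-type function restricted to a convex cone *)

Section Conjugate.
Context {R : realType} {n : nat}.
Notation vec := 'rV[R]_n.
Context (C : set vec) (v : vec -> R) (a : R).
Hypothesis C0 : C 0.
Hypothesis CD : forall x y, C x -> C y -> C (x + y).
Hypothesis CZ : forall (l : R) x, 0 <= l -> C x -> C (l *: x).
Hypothesis vZ : forall (l : R) x, 0 <= l -> C x -> v (l *: x) = l ^+ 2 * v x.
Hypothesis v_convex : forall (t : R) x y, C x -> C y -> 0 <= t <= 1 ->
  v (t *: x + (1 - t) *: y) <= t * v x + (1 - t) * v y.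
Hypothesis a0 : 0 < a.
Hypothesis va : forall x, C x -> a * dot x x <= v x.

Lemma cone_convex (t : R) x y : C x -> C y -> 0 <= t <= 1 ->
  C (t *: x + (1 - t) *: y).
Proof. by move=> Cx Cy t01; apply: CD; apply: CZ => //; lra. Qed.

Lemma quadratic0 : v 0 = 0.
Proof. by have := vZ 0 0 (lexx 0) C0; rewrite scale0r expr0n mul0r. Qed.

(** The universal property of the supremum, so that the conjugate can be handled as a real-valued
    function. *)
Definition is_conjugate (w : vec -> R) : Prop :=
  forall p m, w p <= m <-> forall x, C x -> dot p x - v x <= m.

(** The point 0 of the cone bounds the supremum below by 0, and [dot_young] with [va] bounds it
    above. Points outside [C] contribute only minus infinity. *)
Lemma conjugate_finite (V : vec -> \bar R) :
  (forall x, C x -> V x = (v x)%:E) ->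
  exists2 w, is_conjugate w & conjugate (restrict V C) = EFin \o w.
Proof.
move=> VE.
have conj_le p m : (conjugate (restrict V C) p <= m%:E)%E <->
    forall x, C x -> dot p x - v x <= m.
  split=> [h x Cx|h].
    rewrite -lee_fin; apply: le_trans h; apply: ereal_sup_ubound.
    by exists x => //; rewrite /restrict; case: asboolP => // _; rewrite VE.
  apply: ge_ereal_sup => _ [x _ <-]; rewrite /restrict; case: asboolP => [Cx|_].
    by rewrite VE // lee_fin h.
  by rewrite /= leNye.
have fin p : conjugate (restrict V C) p \is a fin_num.
  rewrite fin_numElt; apply/andP; split.
    rewrite (@lt_le_trans _ _ 0%E) ?ltNy0 //; apply: ereal_sup_ubound.
    exists 0 => //; rewrite /restrict; case: asboolP => // _.
    by rewrite VE // quadratic0 dot0r sube0.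
  apply: (@le_lt_trans _ _ (dot p p / (4 * a))%:E); last exact: ltry.
  apply/conj_le => x Cx; have := dot_young a p x a0; have := va x Cx; lra.
exists (fun p => fine (conjugate (restrict V C) p)); last first.
  by apply/funext => p /=; rewrite fineK.
move=> p m; split=> [h|h].
  by apply/conj_le; rewrite -(fineK (fin p)) lee_fin.
by rewrite -lee_fin fineK //; apply/conj_le.
Qed.

Section FiniteConjugate.
Context (w : vec -> R).
Hypothesis wP : is_conjugate w.

Lemma conj_ge p x : C x -> dot p x - v x <= w p.
Proof. by move=> Cx; have /wP := lexx (w p); apply. Qed.

Lemma conj_ge0 p : 0 <= w p.
Proof. by have := conj_ge p 0 C0; rewrite dot0r quadratic0 subr0. Qed.

Lemma conj_le_dot p : w p <= dot p p / (4 * a).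
Proof.
by apply/wP => x Cx; have := dot_young a p x a0; have := va x Cx; lra.
Qed.

Lemma conj0 : w 0 = 0.
Proof.
by apply/eqP; rewrite eq_le conj_ge0 andbT (le_trans (conj_le_dot 0)) // dot0r mul0r.
Qed.

Lemma conjZ (l : R) p : 0 <= l -> w (l *: p) = l ^+ 2 * w p.
Proof.
rewrite le_eqVlt => /predU1P[<-|l0]; first by rewrite scale0r conj0 expr0n mul0r.
(* Substituting [k^-1 *: x] in the cone gives one inequality; applying it to [l] and to [l^-1] gives
   equality. *)
have conjZ_le (k : R) q : 0 < k -> w (k *: q) <= k ^+ 2 * w q.
  move=> k0; apply/wP => x Cx.
  have k'0 : 0 <= k^-1 by rewrite invr_ge0 ltW.
  have := conj_ge q _ (CZ _ _ k'0 Cx); rewrite vZ // dotZr => h.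
  have k2 : 0 < k ^+ 2 by rewrite exprn_gt0.
  rewrite -(ler_pM2l k2) in h; apply: le_trans h.
  rewrite dotZl le_eqVlt; apply/orP; left; apply/eqP; field.
  by rewrite gt_eqF.
apply/eqP; rewrite eq_le conjZ_le //=.
have l'0 : 0 < l^-1 by rewrite invr_gt0.
have := conjZ_le _ (l *: p) l'0; rewrite scalerA mulVf ?gt_eqF // scale1r => h.
have l2 : 0 < l ^+ 2 by rewrite exprn_gt0.
by rewrite -ler_pdivlMl // -exprVn.
Qed.

Lemma conj_convex (t : R) p q : 0 <= t <= 1 ->
  w (t *: p + (1 - t) *: q) <= t * w p + (1 - t) * w q.
Proof.
move=> /andP[t0 t1]; apply/wP => x Cx; rewrite dotDl !dotZl.
have hp := ler_wpM2l t0 (conj_ge p x Cx).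
have t1' : 0 <= 1 - t by lra.
have hq := ler_wpM2l t1' (conj_ge q x Cx).
lra.
Qed.

Lemma conj_classV : classV (EFin \o w).
Proof.
split; last split; last split; last split.
(* The epigraph is an intersection of closed half-spaces, one for each [x] in [C]. *)
- have -> : epigraph (EFin \o w) =
      \bigcap_(x in C) [set q : vec * R | dot x q.1 - q.2 <= v x].
    apply/seteqP; split=> [q /=|q /= h].
      by rewrite /epigraph /= lee_fin => /wP h x Cx /=; have := h x Cx; rewrite dotC; lra.
    by rewrite /epigraph /= lee_fin; apply/wP => x Cx; have := h x Cx; rewrite /= dotC; lra.
  apply: closed_bigI => x _.
  apply: (@preimage_closed _ _ (fun q : vec * R => dot x q.1 - q.2) [set r | r <= v x]);
    last exact: closed_le.
  move=> q _; apply: cvgB; last exact: cvg_snd.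
  apply: (@continuous_comp _ _ _ fst (dot x)); first exact: cvg_fst.
  exact: dot_continuous.
- move=> p q l; rewrite /epigraph /= !lee_fin => hp hq l01.
  apply: le_trans (conj_convex l p.1 q.1 l01) _.
  by have /andP[l0 l1] := l01; apply: lerD; apply: ler_wpM2l; lra.
- by rewrite /= conj0.
- by move=> x; rewrite lee_fin conj_ge0.
- by move=> l x l0; rewrite /= conjZ // EFinM.
Qed.

(* Scaling x by 1 - t frees the term t * v x, which absorbs the error dot (p - p') x. *)
Lemma maximizer_near_closure (P : set vec) (m m' : R) p' :
  0 < m' < m -> closure P p' ->
  (forall p, P p -> exists x, C x /\ m < dot p x - v x) ->
  exists x, C x /\ m' < dot x p' - v x.
Proof.
move=> /andP[m'0 m'm] Pp' hP; apply: contrapT => /forallNP no.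
have hle x : C x -> dot x p' - v x <= m'.
  by move=> Cx; rewrite leNgt; apply/negP => h; apply: (no x).
(* Here [1 - t = (m + m') / (2 * m)], which makes [k = m' / (1 - t)] smaller than [m]. The gap
   [m - k] is the room left for the distance term of [dot_young]. *)
pose t := (m - m') / (2 * m).
have m0 : 0 < m by lra.
have tE : t * (2 * m) = m - m' by rewrite mulfVK // gt_eqF //; lra.
have t0 : 0 < t by rewrite divr_gt0 //; lra.
have u0 : 0 < 1 - t by nra.
pose k := m' / (1 - t).
have kE : k * (1 - t) = m' by rewrite mulfVK // gt_eqF.
have km : k < m by rewrite ltr_pdivrMr //; lra.
have d0 : 0 < 4 * (a * t) * (m - k) by rewrite mulr_gt0 ?subr_gt0 // mulr_gt0 // mulr_gt0.
have [p Pp pd] := closure_approx P p' _ Pp' d0.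
have [x [Cx hx]] := hP p Pp.
have at0 : 0 < a * t by rewrite mulr_gt0.
have := dot_young (a * t) (p - p') x at0; rewrite dotBl => hy.
have hd : dot (p - p') (p - p') / (4 * (a * t)) < m - k.
  have at4 : 0 < 4 * (a * t) by lra.
  by rewrite ltr_pdivrMr // mulrC.
have hv : a * t * dot x x <= t * v x by rewrite (mulrC a) -mulrA ler_pM2l // va.
have := hle _ (CZ _ _ (ltW u0) Cx); rewrite vZ ?(ltW u0) // dotZl -kE => hk.
have : (1 - t) * (dot x p' - (1 - t) * v x) <= (1 - t) * k by move: hk; lra.
rewrite ler_pM2l // (dotC x) => hk'.
lra.
Qed.

(** Test the conjugate at a multiple of the [x] in [s] whose form exceeds [r], the norm of [p]. The
    scale [r / (2 * N)] maximises [t * r - t ^+ 2 * N], with value [r ^+ 2 / (4 * N)]; the maximum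
    with 1 keeps [N] positive. *)
Lemma conj_lower_bound (F : set vec) (s : seq vec) :
  (forall x, x \in s -> C x) ->
  (forall p, F p -> p != 0 -> exists x, x \in s /\ Num.sqrt (dot p p) < dot x p) ->
  exists2 c, 0 < c & forall p, F p -> c * dot p p <= w p.
Proof.
move=> sC sF; have [M hM] := seq_ubound s v.
pose N := Num.max 1 M.
have N0 : 0 < N by rewrite lt_max ltr01.
exists (4 * N)^-1; first by rewrite invr_gt0 mulr_gt0.
move=> p Fp; have [->|p0] := eqVneq p 0; first by rewrite dot0r mulr0 conj_ge0.
have [x [xs hx]] := sF p Fp p0; set r := Num.sqrt _ in hx.
have r0 : 0 < r by rewrite sqrtr_gt0 dot_gt0.
have t0 : 0 < r / (2 * N) by rewrite divr_gt0 ?mulr_gt0.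
have Cx := sC x xs.
apply: le_trans (conj_ge p _ (CZ _ _ (ltW t0) Cx)).
rewrite vZ ?(ltW t0) // dotZr dotC -(sqr_sqrtr (dot_ge0 p)) -/r.
have vN : v x <= N by rewrite le_max hM // orbT.
have h1 : r / (2 * N) * r <= r / (2 * N) * dot p x.
  by rewrite ler_pM2l // (dotC p) ltW.
have h2 : (r / (2 * N)) ^+ 2 * v x <= (r / (2 * N)) ^+ 2 * N.
  by rewrite ler_pM2l // exprn_gt0.
have e1 : (4 * N)^-1 * r ^+ 2 = r / (2 * N) * r - (r / (2 * N)) ^+ 2 * N.
  by field; rewrite gt_eqF.
by rewrite (dotC x) e1; lra.
Qed.

(** Reduces to [finite_minimax]: the directions in [s] serve points of large norm, and a finite
    subcover serves the compact rest. Compactness needs [closure P], where [maximizer_near_closure]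
    keeps a witness at the price of lowering [m] to [m']. *)
Lemma conic_minimax (F P : set vec) (s : seq vec) (m m' : R) :
  (forall x, x \in s -> C x) ->
  (forall p, F p -> p != 0 -> exists x, x \in s /\ Num.sqrt (dot p p) < dot x p) ->
  P `<=` F -> convex_set P -> 0 < m' < m ->
  (forall p, P p -> exists x, C x /\ m < dot p x - v x) ->
  exists2 x, C x & forall p, P p -> m' <= dot p x - v x.
Proof.
move=> sC sF PF cP m'm hP; have [M hM] := seq_ubound s v.
have /andP[m'0 _] := m'm.
(* Beyond norm [r], some [x] in [s] has [dot x p > r >= m' + v x]. *)
pose r := m' + Num.max 0 M.
have r0 : 0 < r by rewrite ltr_pwDl // le_max lexx.
have [||p [Pp _]|s2 [s2C s2P]] := compact_seq_cover
    (closure P `&` [set p | dot p p <= r ^+ 2]) C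
    (fun x => [set p | m' + v x < dot x p]).
- by apply: compact_dot_le; exact: closed_closure.
- by move=> x _; exact: open_dot_gt.
- have [x [Cx hx]] := maximizer_near_closure P m m' p m'm Pp hP.
  by exists x; split; rewrite //= -ltrBrDr.
pose g x p := dot x p - v x - m'.
have [||||p Pp|x Cx hx] := finite_minimax _ C g _ _ _ (s ++ s2) P cP.
- by move=> x t p q; rewrite /g dotDr !dotZr; ring.
- by exists 0.
(* Convexity of [v] makes [g] concave in [x], so the convex combination itself dominates. *)
- move=> t x y Cx Cy t01; exists (t *: x + (1 - t) *: y); first exact: cone_convex.
  move=> p; rewrite /g dotDl !dotZl.
  by have := v_convex t x y Cx Cy t01; lra.
- by move=> x; rewrite mem_cat => /orP[/sC|/s2C].
- have [pr|pr] := leP (dot p p) (r ^+ 2).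
    have [x [xs hx]] := s2P p (conj (subset_closure Pp) pr).
    exists x; rewrite mem_cat xs orbT; split=> //.
    by rewrite /g; move: hx => /=; lra.
  have p0 : p != 0.
    by apply: contraTneq pr => ->; rewrite dot0r -leNgt exprn_ge0 // ltW.
  have [x [xs hx]] := sF p (PF p Pp) p0.
  exists x; rewrite mem_cat xs; split=> //.
  have rp : r < Num.sqrt (dot p p).
    by rewrite -(ltr_pXn2r (_ : 0 < 2)%N) ?nnegrE ?sqrtr_ge0 ?(ltW r0) // sqr_sqrtr // dot_ge0.
  have vM : v x <= Num.max 0 M by rewrite le_max hM // orbT.
  by rewrite /g; rewrite /r in rp; lra.
by exists x => // p /hx; rewrite /g (dotC x); lra.
Qed.

End FiniteConjugate.
End Conjugate.

(** No unit vector of [closure F] lies in the polar of [C], so each has a positive form from [C],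
    which scaling makes larger than 1. A finite subcover of the compact unit sphere of [closure F]
    gives [s], and homogeneity extends the bound to all of [F]. *)
Lemma uniform_direction {R : realType} {n : nat} (C F : set 'rV[R]_n) :
  (forall (l : R) x, 0 <= l -> C x -> C (l *: x)) ->
  (forall (l : R) x, 0 <= l -> F x -> F (l *: x)) ->
  polar C `&` closure F `<=` [set 0] ->
  exists s : seq 'rV[R]_n, (forall x, x \in s -> C x) /\
    forall p, F p -> p != 0 -> exists x, x \in s /\ Num.sqrt (dot p p) < dot x p.
Proof.
move=> CZ FZ CF0.
have cA : closed (closure F `&` [set p | 1 <= dot p p]).
  apply: closedI; first exact: closed_closure.
  apply: (@preimage_closed _ _ (fun p : 'rV[R]_n => dot p p) [set r | 1 <= r]);
    last exact: closed_ge.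
  by move=> p _; apply: continuous_dot => t; exact: cvg_id.
have [|p [[Fp /= p1] _]|s [sC sP]] := compact_seq_cover _ C
  (fun x => [set p | 1 < dot x p]) (compact_dot_le _ 1 cA).
- by move=> x _; exact: open_dot_gt.
- apply: contrapT => /forallNP no.
  have : [set 0] p.
    apply: CF0; split=> // x Cx; rewrite leNgt; apply/negP => xp.
    (* The factor makes the form equal to 2 at [p], above the threshold 1. *)
    apply: (no ((2 / dot x p) *: x)); split.
      by apply: CZ => //; rewrite divr_ge0 // ltW.
    by rewrite /= dotZl mulfVK ?gt_eqF // ltr1n.
  by move=> /= p0; move: p1; rewrite p0 dot0r ler10.
exists s; split=> // p Fp p0.
set r := Num.sqrt _; have r0 : 0 < r by rewrite sqrtr_gt0 dot_gt0.
have rE : r ^+ 2 = dot p p by rewrite sqr_sqrtr // dot_ge0.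
have q1 : dot (r^-1 *: p) (r^-1 *: p) = 1.
  by rewrite dotZl dotZr -rE; field; rewrite gt_eqF.
have [|x [xs hx]] := sP (r^-1 *: p).
  split; last by rewrite /= q1.
  split; last by rewrite /= q1.
  by apply: subset_closure; apply: FZ => //; rewrite invr_ge0 ltW.
exists x; split=> //; move: hx.
by rewrite /= dotZr mulrC ltr_pdivlMr // mul1r.
Qed.

(** * Feasible sets as convex cones *)

Lemma feasible_cone {R : realType} {n : nat} (G : setmap R n) :
  convex_process G ->
  [/\ feasible G 0,
      forall x y, feasible G x -> feasible G y -> feasible G (x + y) &
      forall (l : R) x, 0 <= l -> feasible G x -> feasible G (l *: x)].
Proof.
move=> [G0 [GD GZ]]; split.
- by exists (fun=> 0).
- move=> _ _ [x [<- xG]] [y [<- yG]]; exists (fun k => x k + y k); split=> // k.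
  exact: (GD (x k, x k.+1) (y k, y k.+1) (xG k) (yG k)).
- move=> l _ l0 [x [<- xG]]; exists (fun k => l *: x k); split=> // k.
  exact: (GZ l (x k, x k.+1) l0 (xG k)).
Qed.

Lemma feasible_step {R : realType} {n : nat} (G : setmap R n) x :
  feasible G x -> exists y, feasible G y /\ G x y.
Proof.
move=> [t [<- tG]]; exists (t 1%N); split; last exact: tG.
by exists (fun k => t k.+1).
Qed.

Lemma epigraph_convex {R : realType} {n : nat} (V : 'rV[R]_n -> \bar R) (t : R) x y (r s : R) :
  convex_set_pair (epigraph V) -> (V x <= r%:E)%E -> (V y <= s%:E)%E -> 0 <= t <= 1 ->
  (V (t *: x + (1 - t) *: y)%R <= (t * r + (1 - t) * s)%:E)%E.
Proof. by move=> cV Vx Vy t01; exact: (cV (x, r) (y, s) t). Qed.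

(** * From strong decrease along [H] to weak decrease along [G] *)

Theorem theorem3 (R : realType) (n : nat) (H G : setmap R n) (V : 'rV[R]_n -> \bar R) :
  convex_process H -> closed_process H ->
  convex_process G -> closed_process G ->
  polar (feasible H) `&` closure (feasible G) = [set 0] ->
  (forall x q, feasible H x -> feasible G q ->
     (ereal_inf [set (dot p x)%:E | p in feasible G `&` G q]
      <= ereal_sup [set (dot y q)%:E | y in feasible H `&` H x])%E) ->
  strong_lyapunov V H ->
  weak_lyapunov (conjugate (restrict V (feasible H))) G.
Proof.
move=> Hcvx _ Gcvx _ polarHG duality.
move=> [[_ [Vcvx [_ [_ VZ]]]] [[a [b [a0 [_ Vab]]]] [c [/andP[c0 c1] Vdec]]]].
have [C0 CD CZ] := feasible_cone H Hcvx.
have [F0 FD FZ] := feasible_cone G Gcvx.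
have [|s [sC sF]] := uniform_direction (feasible H) (feasible G) CZ FZ.
  by rewrite polarHG.
(* [V] is finite on [feasible H] by positive definiteness; elsewhere [fine] may return its default
   0, so [v] is only evaluated on that cone. *)
pose v x := fine (V x).
have VE x : feasible H x -> V x = (v x)%:E.
  move=> /Vab[aV Vb]; rewrite fineK // fin_numElt.
  by rewrite (lt_le_trans _ aV) ?ltNyr // (le_lt_trans Vb) // ltry.
have vZ (l : R) x : 0 <= l -> feasible H x -> v (l *: x) = l ^+ 2 * v x.
  by move=> l0 Cx; rewrite /v VZ // VE.
have va x : feasible H x -> a * dot x x <= v x.
  by move=> Cx; have [+ _] := Vab x Cx; rewrite VE // lee_fin.
have v_cvx (t : R) x y : feasible H x -> feasible H y -> 0 <= t <= 1 ->
    v (t *: x + (1 - t) *: y) <= t * v x + (1 - t) * v y.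
  move=> Cx Cy t01; rewrite -lee_fin -VE; last exact: (cone_convex _ CD CZ).
  by apply: epigraph_convex => //; rewrite VE.
have [w wP ->] := conjugate_finite _ v a C0 vZ a0 va V VE.
have wge := conj_ge _ _ w wP.
have w0 p : 0 <= w p by exact: (conj_ge0 _ v C0 vZ w wP).
have wle p : w p <= dot p p / (4 * a) by exact: (conj_le_dot _ v a a0 va w wP).
have [d d0 dw] := conj_lower_bound _ v C0 CZ vZ w wP (feasible G) s sC sF.
split; first exact: (conj_classV _ v a C0 CZ vZ a0 va w wP).
split.
  (* The maximum secures [alpha <= beta] even when [feasible G] is reduced to 0 and nothing compares
     the two constants. *)
  exists d, (Num.max d (4 * a)^-1); split=> //; split; first by rewrite le_max lexx.
  move=> p Fp; rewrite !lee_fin dw //; split=> //; apply: le_trans (wle p) _.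
  by rewrite mulrC ler_wpM2r ?dot_ge0 // le_max lexx orbT.
exists ((1 + c) / 2); split; first by lra.
move=> q Fq; rewrite -EFinM.
(* The minimax step needs positive levels, hence [w q > 0]; for [q = 0] the successor 0 works. *)
have [q0|q0] := eqVneq q 0.
  have w00 : w 0 = 0 by exact: (conj0 _ v a C0 vZ a0 va w wP).
  exists 0; rewrite q0 /= w00 mulr0; split=> //; split=> //.
  by have [] := Gcvx.
have wq0 : 0 < w q by rewrite (lt_le_trans _ (dw q Fq)) // mulr_gt0 // dot_gt0.
apply: contrapT => /forallNP no.
(* The factors [(1 + c) / 2], [(1 + 3 * c) / 4], [(1 + 7 * c) / 8] successively halve the distance
   to [c]. The first loss pays for the minimax, the second for a supremum that need not be attained;
   [m0] still exceeds [c * w q]. *)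
pose m1 := (1 + 3 * c) / 4 * w q.
pose m0 := (1 + 7 * c) / 8 * w q.
have m1m : 0 < m1 < (1 + c) / 2 * w q.
  by rewrite /m1 ltr_pM2r // mulr_gt0 //=; lra.
have Pcvx : convex_set (feasible G `&` G q).
  move=> t p p' [Fp Gp] [Fp' Gp'] t01; split; first exact: (cone_convex _ FD FZ).
  have [_ [GD GZ]] := Gcvx; have /andP[t0 t1] := t01.
  have t1' : 0 <= 1 - t by lra.
  have := GD _ _ (GZ t (q, p) t0 Gp) (GZ (1 - t) (q, p') t1' Gp').
  by rewrite /graph /= -scalerDl subrKC scale1r.
have [p [Fp Gp]|x Cx hx] := conic_minimax _ v a C0 CD CZ vZ v_cvx a0 va _ _ s _ _
    sC sF (@subIsetl _ _ _) Pcvx m1m.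
  apply: contrapT => /forallNP nox; apply: (no p); split=> //; split=> //.
  rewrite lee_fin; apply/wP => x Cx; rewrite leNgt; apply/negP => lt.
  by apply: (nox x).
have : ((m0 + v x)%:E < ereal_sup [set (dot y q)%:E | y in feasible H `&` H x])%E.
  apply: lt_le_trans (duality x q Cx Fq).
  apply: (@lt_le_trans _ _ (m1 + v x)%:E).
    by rewrite lte_fin ltrD2r /m0 /m1 ltr_pM2r //; lra.
  by apply: le_ereal_inf_tmp => _ [p Pp <-]; rewrite lee_fin; have := hx p Pp; lra.
move=> /ereal_sup_gt[_ [y [Cy Hxy] <-]]; rewrite lte_fin => hy.
have vyx : v y <= c * v x.
  by have := Vdec x Cx y Cy Hxy; rewrite !VE // -EFinM lee_fin.
have c'0 : 0 <= c^-1 by rewrite invr_ge0 ltW.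
(* Testing [w q] at [c^-1 *: y] and multiplying by [c] gives [c * w q >= dot y q - c^-1 * v y >= dot
   y q - v x > m0], a contradiction. *)
have := wge q _ (CZ _ _ c'0 Cy); rewrite vZ // dotZr (dotC q).
rewrite -(ler_pM2l c0) mulrBr mulrA mulfV ?gt_eqF // mul1r mulrA expr2 mulrA.
rewrite mulfV ?gt_eqF // mul1r => hw.
have hv : c^-1 * v y <= v x by rewrite ler_pdivrMl.
have : m0 < c * w q by lra.
by rewrite /m0 ltr_pM2r //; lra.
Qed.
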